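(* The vertical arrows of $\mathbf{RLP}(\mathbb D)$ are exactly the degenerate-preferring Kan fibrations. That is, sending a vertical arrow $(f,\psi)$ of $\mathbf{RLP}(\mathbb D)$ to $f$ together with the restriction of $\psi$ to horn inclusions is a bijection onto the degenerate-preferring Kan fibrations $(f,\mathrm{lift})$.
   Context: Simplicial sets. $\Delta^n$ is the standard $n$-simplex; $s_j:\Delta^{n+1}\to\Delta^n$ ($0\le j\le n$) is the degeneracy map hitting $j$ twice. For $n\ge1$, $0\le m\le n$, the horn $\Lambda^n_m\subseteq\Delta^n$ is the union of the faces $d_k$, $k\ne m$, and $\iota:\Lambda^n_m\hookrightarrow\Delta^n$ is the horn inclusion. Kan fibrations. A functional Kan fibration is a map $\alpha:X\to Y$ of simplicial sets with a function $\mathrm{lift}$ assigning to every horn inclusion $\iota:\Lambda^n_m\hookrightarrow\Delta^n$ and all $x:\Lambda^n_m\to X$, $y:\Delta^n\to Y$ with $\alpha x=y\iota$ a map $\mathrm{lift}(x,y):\Delta^n\to X$ with $\mathrm{lift}(x,y)\iota=x$, $\alpha\,\mathrm{lift}(x,y)=y$. It is degenerate-preferring if whenever $(x,y)$ has a solution of the form $z\circ s_j$ with $z:\Delta^{n-1}\to X$, then $\mathrm{lift}(x,y)$ is such a solution (such degenerate solutions are unique when they exist). Double categories. A double category has objects, horizontal arrows, vertical arrows and squares, with the usual compositions and identities. $\mathbb S\mathbf q(\mathcal C)$ is the double category with objects those of $\mathcal C$, both kinds of arrows the arrows of $\mathcal C$, and squares the commutative squares; a square with left vertical side $l$, right vertical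 side $r$, top $u$ and bottom $v$ is written $[u,v]:l\to r$. A double category over $\mathcal C$ is a double functor $L:\mathbb L\to\mathbb S\mathbf q(\mathcal C)$. A square $\lambda:l'\to l$ of $\mathbb L$ has left side $l'$ and right side $l$. $\mathbf{RLP}(\mathbb L)$. For $L:\mathbb L\to\mathbb S\mathbf q(\mathcal C)$, a vertical arrow of $\mathbf{RLP}(\mathbb L)$ is a pair $(f,\psi)$ with $f:X\to Y$ in $\mathcal C$ and $\psi$ a function assigning to each vertical arrow $l:A\to B$ of $\mathbb L$ and each commutative square $[u,v]:Ll\to f$ a map $\psi_l(u,v):LB\to X$ with $\psi_l(u,v)\circ Ll=u$ and $f\circ\psi_l(u,v)=v$, such that: (horizontal compatibility) for every square $\lambda:l'\to l$ of $\mathbb L$ with top $a$ and bottom $b$, $\psi_{l'}(u\circ La,v\circ Lb)=\psi_l(u,v)\circ Lb$; (vertical compatibility) for composable vertical arrows $l,l'$ of $\mathbb L$, $\psi_{l'\circ l}(u,v)=\psi_{l'}(\psi_l(u,v\circ Ll'),v)$. The double category $\mathbb D$ over $\mathbf{sSet}$. Objects: the simplices $\Delta^n$ and the horns $\Lambda^n_m$. Vertical arrows: identities and the horn inclusions $\iota:\Lambda^n_m\hookrightarrow\Delta^n$. Horizontal arrows: $\Delta^a\to\Delta^b$ are the epimorphisms; between horns only the identities; $\Lambda^n_m\to\Delta^b$ are the maps $s\circ\iota$ with $\iota:\Lambda^n_m\hookrightarrow\Delta^n$ the horn inclusion and $s:\Delta^n\to\Delta^b$ a non-identity epimorphism. Squares: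 identity squares on vertical and on horizontal arrows, and the squares with left side $\iota:\Lambda^n_m\hookrightarrow\Delta^n$, right side $\mathrm{id}_{\Delta^b}$, top $s\circ\iota$ and bottom $s$, for $\iota$ a horn inclusion and $s:\Delta^n\to\Delta^b$ a non-identity epimorphism. The double functor $\mathbb D\to\mathbb S\mathbf q(\mathbf{sSet})$ is the evident inclusion. *)

(* Defs.v *)
From mathcomp Require Import all_boot.
From Stdlib Require Import Program.Equality.
From mathcomp Require Import boolp.

Set Implicit Arguments.
Unset Strict Implicit.
Unset Printing Implicit Defensive.

Record cat_on (O : Type) := CatOn {
  hom : O -> O -> Type;
  idc : forall x, hom x x;
  cmp : forall x y z, hom y z -> hom x y -> hom x z;
  cmp1f : forall x y (f : hom x y), cmp (idc y) f = f;
  cmpf1 : forall x y (f : hom x y), cmp f (idc x) = f;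
  cmpA : forall x y z t (h : hom z t) (g : hom y z) (f : hom x y),
    cmp h (cmp g f) = cmp (cmp h g) f }.

Record category := Category {
  ob :> Type;
  cat_of :> cat_on ob }.

Definition epi (C : category) (x y : C) (s : hom C x y) : Prop :=
  forall z (g h : hom C y z), cmp g s = cmp h s -> g = h.

(* Equality of squares whose four corners agree but whose sides are a priori
   only propositionally equal (needed e.g. to state associativity). *)
Inductive sq_eq (T1 T2 T3 T4 : Type) (S : T1 -> T2 -> T3 -> T4 -> Type)
    l r u v (s : S l r u v) : forall l' r' u' v', S l' r' u' v' -> Prop :=
  SqEq : @sq_eq T1 T2 T3 T4 S l r u v s l r u v s.

(* [sq l r u v] is the type of the squares with left side [l], right side [r],
   top [u] and bottom [v]:
<<
          A --u--> B
          |        |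
          l        r
          v        v
          A' -v--> B'
>>
*)
Record dblcat := DblCat {
  dob :> Type;
  hcat : cat_on dob;
  vcat : cat_on dob;
  sq : forall A B A' B', hom vcat A A' -> hom vcat B B' ->
    hom hcat A B -> hom hcat A' B' -> Type;
  sq_hid : forall A A' (l : hom vcat A A'), sq l l (idc hcat A) (idc hcat A');
  sq_vid : forall A B (u : hom hcat A B), sq (idc vcat A) (idc vcat B) u u;
  sq_hcmp : forall A B C A' B' C'
    (l : hom vcat A A') (m : hom vcat B B') (r : hom vcat C C')
    (u : hom hcat A B) (v : hom hcat A' B')
    (u' : hom hcat B C) (v' : hom hcat B' C'),
    sq m r u' v' -> sq l m u v -> sq l r (cmp u' u) (cmp v' v);
  sq_vcmp : forall A B A' B' A'' B''
    (l : hom vcat A A') (r : hom vcat B B')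
    (l' : hom vcat A' A'') (r' : hom vcat B' B'')
    (u : hom hcat A B) (v : hom hcat A' B') (w : hom hcat A'' B''),
    sq l' r' v w -> sq l r u v -> sq (cmp l' l) (cmp r' r) u w;
  sq_hcmp1s : forall A B A' B' (l : hom vcat A A') (r : hom vcat B B')
    (u : hom hcat A B) (v : hom hcat A' B') (s : sq l r u v),
    sq_eq (sq_hcmp (sq_hid r) s) s;
  sq_hcmps1 : forall A B A' B' (l : hom vcat A A') (r : hom vcat B B')
    (u : hom hcat A B) (v : hom hcat A' B') (s : sq l r u v),
    sq_eq (sq_hcmp s (sq_hid l)) s;
  sq_hcmpA : forall A B C D A' B' C' D'
    (k : hom vcat A A') (l : hom vcat B B')
    (m : hom vcat C C') (r : hom vcat D D')
    (u1 : hom hcat A B) (v1 : hom hcat A' B')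
    (u2 : hom hcat B C) (v2 : hom hcat B' C')
    (u3 : hom hcat C D) (v3 : hom hcat C' D')
    (s3 : sq m r u3 v3) (s2 : sq l m u2 v2) (s1 : sq k l u1 v1),
    sq_eq (sq_hcmp s3 (sq_hcmp s2 s1)) (sq_hcmp (sq_hcmp s3 s2) s1);
  sq_vcmp1s : forall A B A' B' (l : hom vcat A A') (r : hom vcat B B')
    (u : hom hcat A B) (v : hom hcat A' B') (s : sq l r u v),
    sq_eq (sq_vcmp (sq_vid v) s) s;
  sq_vcmps1 : forall A B A' B' (l : hom vcat A A') (r : hom vcat B B')
    (u : hom hcat A B) (v : hom hcat A' B') (s : sq l r u v),
    sq_eq (sq_vcmp s (sq_vid u)) s;
  sq_vcmpA : forall A0 B0 A1 B1 A2 B2 A3 B3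
    (l1 : hom vcat A0 A1) (r1 : hom vcat B0 B1)
    (l2 : hom vcat A1 A2) (r2 : hom vcat B1 B2)
    (l3 : hom vcat A2 A3) (r3 : hom vcat B2 B3)
    (u0 : hom hcat A0 B0) (u1 : hom hcat A1 B1)
    (u2 : hom hcat A2 B2) (u3 : hom hcat A3 B3)
    (s3 : sq l3 r3 u2 u3) (s2 : sq l2 r2 u1 u2) (s1 : sq l1 r1 u0 u1),
    sq_eq (sq_vcmp s3 (sq_vcmp s2 s1)) (sq_vcmp (sq_vcmp s3 s2) s1);
  sq_interchange : forall A B C A' B' C' A'' B'' C''
    (l : hom vcat A A') (m : hom vcat B B') (r : hom vcat C C')
    (l' : hom vcat A' A'') (m' : hom vcat B' B'') (r' : hom vcat C' C'')
    (u1 : hom hcat A B) (u2 : hom hcat B C)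
    (v1 : hom hcat A' B') (v2 : hom hcat B' C')
    (w1 : hom hcat A'' B'') (w2 : hom hcat B'' C'')
    (s1 : sq l m u1 v1) (s2 : sq m r u2 v2)
    (t1 : sq l' m' v1 w1) (t2 : sq m' r' v2 w2),
    sq_vcmp (sq_hcmp t2 t1) (sq_hcmp s2 s1) =
    sq_hcmp (sq_vcmp t2 s2) (sq_vcmp t1 s1);
  sq_hid_cmp : forall A A' A'' (l' : hom vcat A' A'') (l : hom vcat A A'),
    sq_hid (cmp l' l) = sq_vcmp (sq_hid l') (sq_hid l);
  sq_vid_cmp : forall A B C (u' : hom hcat B C) (u : hom hcat A B),
    sq_vid (cmp u' u) = sq_hcmp (sq_vid u') (sq_vid u);
  sq_hid_vid : forall A, sq_hid (idc vcat A) = sq_vid (idc hcat A) }.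

Notation hor D := (hom (hcat D)).
Notation ver D := (hom (vcat D)).

Record dblfunctor (D E : dblcat) := DblFunctor {
  fob :> D -> E;
  fhor : forall A B, hor D A B -> hor E (fob A) (fob B);
  fver : forall A B, ver D A B -> ver E (fob A) (fob B);
  fsq : forall A B A' B' (l : ver D A A') (r : ver D B B')
    (u : hor D A B) (v : hor D A' B'),
    sq l r u v -> sq (fver l) (fver r) (fhor u) (fhor v);
  fhor_id : forall A, fhor (idc (hcat D) A) = idc (hcat E) (fob A);
  fhor_cmp : forall A B C (u' : hor D B C) (u : hor D A B),
    fhor (cmp u' u) = cmp (fhor u') (fhor u);
  fver_id : forall A, fver (idc (vcat D) A) = idc (vcat E) (fob A);
  fver_cmp : forall A B C (l' : ver D B C) (l : ver D A B),
    fver (cmp l' l) = cmp (fver l') (fver l);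
  fsq_hid : forall A A' (l : ver D A A'),
    sq_eq (fsq (sq_hid l)) (sq_hid (fver l));
  fsq_vid : forall A B (u : hor D A B),
    sq_eq (fsq (sq_vid u)) (sq_vid (fhor u));
  fsq_hcmp : forall A B C A' B' C'
    (l : ver D A A') (m : ver D B B') (r : ver D C C')
    (u : hor D A B) (v : hor D A' B') (u' : hor D B C) (v' : hor D B' C')
    (t : sq m r u' v') (s : sq l m u v),
    sq_eq (fsq (sq_hcmp t s)) (sq_hcmp (fsq t) (fsq s));
  fsq_vcmp : forall A B A' B' A'' B''
    (l : ver D A A') (r : ver D B B') (l' : ver D A' A'') (r' : ver D B' B'')
    (u : hor D A B) (v : hor D A' B') (w : hor D A'' B'')
    (t : sq l' r' v w) (s : sq l r u v),
    sq_eq (fsq (sq_vcmp t s)) (sq_vcmp (fsq t) (fsq s)) }.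

Lemma sq_eq_thin (T1 T2 T3 T4 : Type) (S : T1 -> T2 -> T3 -> T4 -> Prop)
    l r u v (s : S l r u v) l' r' u' v' (s' : S l' r' u' v') :
  l = l' -> r = r' -> u = u' -> v = v' -> sq_eq s s'.
Proof.
by move=> el er eu ev; subst; rewrite (Prop_irrelevance s s').
Qed.

Lemma sval_eq (T : Type) (P : T -> Prop) (u v : {x | P x}) :
  sval u = sval v -> u = v.
Proof. by case: u v => [x p] [y q] /= e; apply: eq_exist. Qed.

Section Squares.
Variable C : category.

Definition comm_sq (A B A' B' : C) (l : hom C A A') (r : hom C B B')
  (u : hom C A B) (v : hom C A' B') : Prop := cmp r u = cmp v l.

Lemma comm_sq_hid A A' (l : hom C A A') : comm_sq l l (idc C A) (idc C A').
Proof. by rewrite /comm_sq cmp1f cmpf1. Qed.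

Lemma comm_sq_vid A B (u : hom C A B) : comm_sq (idc C A) (idc C B) u u.
Proof. by rewrite /comm_sq cmp1f cmpf1. Qed.

Lemma comm_sq_hcmp (A B D A' B' D' : C)
    (l : hom C A A') (m : hom C B B') (r : hom C D D')
    (u : hom C A B) (v : hom C A' B') (u' : hom C B D) (v' : hom C B' D') :
  comm_sq m r u' v' -> comm_sq l m u v -> comm_sq l r (cmp u' u) (cmp v' v).
Proof. by rewrite /comm_sq => e e'; rewrite cmpA e -cmpA e' cmpA. Qed.

Lemma comm_sq_vcmp (A B A' B' A'' B'' : C)
    (l : hom C A A') (r : hom C B B') (l' : hom C A' A'') (r' : hom C B' B'')
    (u : hom C A B) (v : hom C A' B') (w : hom C A'' B'') :
  comm_sq l' r' v w -> comm_sq l r u v -> comm_sq (cmp l' l) (cmp r' r) u w.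
Proof. by rewrite /comm_sq => e e'; rewrite -cmpA e' cmpA e -cmpA. Qed.

Definition Sq : dblcat.
Proof.
refine (@DblCat C C C comm_sq comm_sq_hid comm_sq_vid comm_sq_hcmp comm_sq_vcmp
  _ _ _ _ _ _ _ _ _ _); intros;
  by [apply: sq_eq_thin; rewrite ?cmp1f ?cmpf1 ?cmpA | apply: Prop_irrelevance].
Defined.

(* A double category with a chosen class of squares of [Sq C], each determined by
   its sides. The objects are given by a family [F] which need not be injective,
   so that formally distinct objects remain distinct. *)
Section SubSq.
Variables (O : Type) (F : O -> C).
Variables PH PV : forall x y, hom C (F x) (F y) -> Prop.
Variable PS : forall x y x' y', hom C (F x) (F x') -> hom C (F y) (F y') ->
  hom C (F x) (F y) -> hom C (F x') (F y') -> Prop.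

Record sub_closed : Prop := SubClosed {
  PH_id : forall x, @PH x x (idc C (F x));
  PH_cmp : forall x y z (g : hom C (F y) (F z)) (f : hom C (F x) (F y)),
    PH g -> PH f -> PH (cmp g f);
  PV_id : forall x, @PV x x (idc C (F x));
  PV_cmp : forall x y z (g : hom C (F y) (F z)) (f : hom C (F x) (F y)),
    PV g -> PV f -> PV (cmp g f);
  PS_comm : forall x y x' y' (l : hom C (F x) (F x')) (r : hom C (F y) (F y'))
    (u : hom C (F x) (F y)) (v : hom C (F x') (F y')),
    PS l r u v -> comm_sq l r u v;
  PS_hid : forall x y (l : hom C (F x) (F y)), PV l ->
    PS l l (idc C (F x)) (idc C (F y));
  PS_vid : forall x y (u : hom C (F x) (F y)), PH u ->
    PS (idc C (F x)) (idc C (F y)) u u;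
  PS_hcmp : forall x y z x' y' z' (l : hom C (F x) (F x'))
    (m : hom C (F y) (F y')) (r : hom C (F z) (F z'))
    (u : hom C (F x) (F y)) (v : hom C (F x') (F y'))
    (u' : hom C (F y) (F z)) (v' : hom C (F y') (F z')),
    PS m r u' v' -> PS l m u v -> PS l r (cmp u' u) (cmp v' v);
  PS_vcmp : forall x y x' y' x'' y''
    (l : hom C (F x) (F x')) (r : hom C (F y) (F y'))
    (l' : hom C (F x') (F x'')) (r' : hom C (F y') (F y''))
    (u : hom C (F x) (F y)) (v : hom C (F x') (F y'))
    (w : hom C (F x'') (F y'')),
    PS l' r' v w -> PS l r u v -> PS (cmp l' l) (cmp r' r) u w }.

Definition sub_cat (P : forall x y, hom C (F x) (F y) -> Prop)
  (P1 : forall x, P x x (idc C (F x)))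
  (PM : forall x y z (g : hom C (F y) (F z)) (f : hom C (F x) (F y)),
    P y z g -> P x y f -> P x z (cmp g f)) : cat_on O.
Proof.
refine (@CatOn O (fun x y => {f : hom C (F x) (F y) | P x y f})
  (fun x => exist _ (idc C (F x)) (P1 x))
  (fun x y z g f => exist _ (cmp (sval g) (sval f))
                      (PM x y z _ _ (svalP g) (svalP f))) _ _ _);
  intros; apply: sval_eq => /=.
- exact: cmp1f.
- exact: cmpf1.
- exact: cmpA.
Defined.

Hypothesis closed : sub_closed.

Definition SubSq : dblcat.
Proof.
refine (@DblCat O (sub_cat (PH_id closed) (PH_cmp closed))
  (sub_cat (PV_id closed) (PV_cmp closed))
  (fun x y x' y' l r u v => PS (sval l) (sval r) (sval u) (sval v))
  (fun x x' l => PS_hid closed (svalP l))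
  (fun x y u => PS_vid closed (svalP u))
  (fun x y z x' y' z' l m r u v u' v' t s => PS_hcmp closed t s)
  (fun x y x' y' x'' y'' l r l' r' u v w t s => PS_vcmp closed t s)
  _ _ _ _ _ _ _ _ _ _); intros;
  by [apply: sq_eq_thin; rewrite ?cmp1f ?cmpf1 ?cmpA | apply: Prop_irrelevance].
Defined.

Definition SubSq_incl : dblfunctor SubSq Sq.
Proof.
refine (@DblFunctor SubSq Sq F (fun x y u => sval u) (fun x y l => sval l)
  (fun x y x' y' l r u v s => PS_comm closed s) _ _ _ _ _ _ _ _); intros;
  by [|apply: (sq_eq_thin (S := @comm_sq _ _ _ _))].
Defined.

End SubSq.

(* The commutativity proofs of the auxiliary squares in the two compatibility
   conditions always exist; as they are unique, it is harmless (and convenient)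
   to quantify over them. *)
Record rlp (L : dblcat) (F : dblfunctor L Sq) (X Y : C) := Rlp {
  rlp_map : hom C X Y;
  psi : forall A B (l : ver L A B) (u : hom C (F A) X) (v : hom C (F B) Y),
    comm_sq (fver F l) rlp_map u v -> hom C (F B) X;
  psi_up : forall A B (l : ver L A B) u v (s : comm_sq (fver F l) rlp_map u v),
    cmp (psi s) (fver F l : hom C _ _) = u;
  psi_down : forall A B (l : ver L A B) u v
    (s : comm_sq (fver F l) rlp_map u v), cmp rlp_map (psi s) = v;
  psi_hor : forall A' B' A B (l' : ver L A' B') (l : ver L A B)
    (a : hor L A' A) (b : hor L B' B) (lambda : sq l' l a b)
    (u : hom C (F A) X) (v : hom C (F B) Y)
    (s : comm_sq (fver F l) rlp_map u v)
    (s' : comm_sq (fver F l') rlp_map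
            (cmp u (fhor F a : hom C _ _)) (cmp v (fhor F b : hom C _ _))),
    psi s' = cmp (psi s) (fhor F b : hom C _ _);
  psi_ver : forall A B B' (l : ver L A B) (l' : ver L B B')
    (u : hom C (F A) X) (v : hom C (F B') Y)
    (s : comm_sq (fver F (cmp l' l)) rlp_map u v)
    (s1 : comm_sq (fver F l) rlp_map u (cmp v (fver F l' : hom C _ _)))
    (s2 : comm_sq (fver F l') rlp_map (psi s1) v),
    psi s = psi s2 }.

End Squares.

(* The morphisms [m] -> [n] of the simplex category. *)
Record mono m n := Mono {
  mono_fun :> 'I_m.+1 -> 'I_n.+1;
  mono_le : forall i j : 'I_m.+1, i <= j -> mono_fun i <= mono_fun j }.

Lemma mono_eq m n (f g : mono m n) : f =1 g -> f = g.
Proof.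
case: f g => [f cf] [g cg] /= /funext e; subst g.
by rewrite (Prop_irrelevance cf cg).
Qed.

Definition mono_id n : mono n n := @Mono n n id (fun i j le_ij => le_ij).

Definition mono_cmp m n p (g : mono n p) (f : mono m n) : mono m p :=
  @Mono m p (g \o f) (fun i j le_ij => mono_le g (mono_le f le_ij)).

Record sset := SSet {
  simp :> nat -> Type;
  act : forall m n, mono m n -> simp n -> simp m;
  act_id : forall n (x : simp n), act (mono_id n) x = x;
  act_cmp : forall m n p (g : mono n p) (f : mono m n) (x : simp p),
    act (mono_cmp g f) x = act f (act g x) }.

Record smap (X Y : sset) := SMap {
  sfun :> forall n, X n -> Y n;
  sfun_nat : forall m n (f : mono m n) (x : X n),
    sfun (act f x) = act f (sfun x) }.

Lemma smap_eq (X Y : sset) (f g : smap X Y) :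
  (forall n (x : X n), f n x = g n x) -> f = g.
Proof.
case: f g => [f cf] [g cg] /= e.
have {}e : f = g.
  by apply: functional_extensionality_dep => n; apply: funext => x; apply: e.
by subst g; rewrite (Prop_irrelevance cf cg).
Qed.

Definition smap_id (X : sset) : smap X X.
Proof. by exists (fun n x => x). Defined.

Definition smap_cmp (X Y Z : sset) (g : smap Y Z) (f : smap X Y) : smap X Z.
Proof.
by exists (fun n x => g n (f n x)) => m n h x; rewrite !sfun_nat.
Defined.

Definition sSet : category.
Proof.
refine (@Category sset (@CatOn sset smap smap_id smap_cmp _ _ _)) => *;
  exact: smap_eq.
Defined.

Definition simplex (n : nat) : sset.
Proof.
refine (@SSet (fun k => mono k n) (fun k l f x => mono_cmp x f) _ _) => *;
  exact: mono_eq.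
Defined.

Definition simplex_map a b (f : mono a b) : smap (simplex a) (simplex b).
Proof.
by exists (fun k (x : simplex a k) => mono_cmp f x : simplex b k) => *;
  apply: mono_eq.
Defined.

Definition coface p (k : 'I_p.+2) : mono p p.+1.
Proof.
by exists (lift k : 'I_p.+1 -> 'I_p.+2) => i j; rewrite leq_bump2.
Defined.

Definition face p (k : 'I_p.+2) : smap (simplex p) (simplex p.+1) :=
  simplex_map (coface k).

Lemma codeg_lt p (j : 'I_p.+1) (i : 'I_p.+2) : unbump j i < p.+1.
Proof.
rewrite /unbump; case: (ltnP j i) => h.
  rewrite -[nat_of_bool _]/1 subn1 -ltnS (ltn_predK h).
  by rewrite ltn_ord.
by rewrite -[nat_of_bool _]/0 subn0 (leq_ltn_trans h).
Qed.

(* [unbump j i] is [i] if [i <= j] and [i.-1] otherwise. *)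
Definition codeg p (j : 'I_p.+1) : mono p.+1 p.
Proof.
exists (fun i : 'I_p.+2 => Ordinal (codeg_lt j i)) => i k /=.
rewrite -leq_bump unbumpKcond => h.
by case: eqP => [e|_] /=; rewrite ?add0n // (leq_trans h) ?leq_addl.
Defined.

Definition degen p (j : 'I_p.+1) : smap (simplex p.+1) (simplex p) :=
  simplex_map (codeg j).

(* Since horns live in dimension n >= 1 we write n = p.+1: for m in
   {0, ..., p+1}, [horn m] is the horn of [simplex p.+1] omitting the face m. *)
Definition in_horn p (m : 'I_p.+2) n (x : simplex p.+1 n) : Prop :=
  exists k : 'I_p.+2, k <> m /\ exists y : simplex p n, x = face k n y.

Lemma in_horn_act p (m : 'I_p.+2) a b (f : mono a b) (x : simplex p.+1 b) :
  in_horn m x -> in_horn m (act f x).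
Proof.
by move=> [k [km [y ->]]]; exists k; split=> //; exists (act f y);
  rewrite sfun_nat.
Qed.

Definition horn p (m : 'I_p.+2) : sset.
Proof.
refine (@SSet (fun n => {x : simplex p.+1 n | in_horn m x})
  (fun a b f x => exist _ (act f (sval x)) (in_horn_act f (svalP x))) _ _) => *;
  apply: sval_eq; [exact: act_id | exact: act_cmp].
Defined.

Definition horn_incl p (m : 'I_p.+2) : smap (horn m) (simplex p.+1).
Proof. by exists (fun n (x : horn m n) => sval x). Defined.

Record kan_fibration (X Y : sset) := KanFibration {
  kan_map : smap X Y;
  kan_lift : forall p (m : 'I_p.+2) (x : smap (horn m) X)
    (y : smap (simplex p.+1) Y),
    smap_cmp kan_map x = smap_cmp y (horn_incl m) -> smap (simplex p.+1) X;
  kan_lift_up : forall p (m : 'I_p.+2) x y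
    (e : smap_cmp kan_map x = smap_cmp y (horn_incl m)),
    smap_cmp (kan_lift e) (horn_incl m) = x;
  kan_lift_down : forall p (m : 'I_p.+2) x y
    (e : smap_cmp kan_map x = smap_cmp y (horn_incl m)),
    smap_cmp kan_map (kan_lift e) = y }.

Definition is_solution (X Y : sset) (f : smap X Y) p (m : 'I_p.+2)
    (x : smap (horn m) X) (y : smap (simplex p.+1) Y)
    (d : smap (simplex p.+1) X) : Prop :=
  smap_cmp d (horn_incl m) = x /\ smap_cmp f d = y.

Definition is_degenerate (X : sset) p (d : smap (simplex p.+1) X) : Prop :=
  exists (j : 'I_p.+1) (z : smap (simplex p) X), d = smap_cmp z (degen j).

Definition degenerate_preferring (X Y : sset) (k : kan_fibration X Y) : Prop :=
  forall p (m : 'I_p.+2) x y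
    (e : smap_cmp (kan_map k) x = smap_cmp y (horn_incl m)),
    (exists d, is_solution (kan_map k) x y d /\ is_degenerate d) ->
    is_solution (kan_map k) x y (kan_lift e) /\ is_degenerate (kan_lift e).

Inductive Dob : Type :=
| Simplex of nat
| Horn p of 'I_p.+2.

Definition Dobj (x : Dob) : sSet :=
  match x with
  | Simplex n => simplex n
  | Horn p m => horn m
  end.

Inductive is_simplex_id : forall a b, smap (simplex a) (simplex b) -> Prop :=
| SimplexId n : is_simplex_id (smap_id (simplex n)).

Definition nonid_epi a b (s : smap (simplex a) (simplex b)) : Prop :=
  epi (C := sSet) s /\ ~ is_simplex_id s.

Inductive Dver : forall x y, hom sSet (Dobj x) (Dobj y) -> Prop :=
| DverId x : @Dver x x (idc sSet (Dobj x))
| DverHorn p (m : 'I_p.+2) : @Dver (Horn m) (Simplex p.+1) (horn_incl m).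

Inductive Dhor : forall x y, hom sSet (Dobj x) (Dobj y) -> Prop :=
| DhorEpi a b (s : smap (simplex a) (simplex b)) :
    epi (C := sSet) s -> @Dhor (Simplex a) (Simplex b) s
| DhorId p (m : 'I_p.+2) : @Dhor (Horn m) (Horn m) (smap_id (horn m))
| DhorHorn p (m : 'I_p.+2) b (s : smap (simplex p.+1) (simplex b)) :
    nonid_epi s -> @Dhor (Horn m) (Simplex b) (smap_cmp s (horn_incl m)).

Inductive Dsq : forall x y x' y',
    hom sSet (Dobj x) (Dobj x') -> hom sSet (Dobj y) (Dobj y') ->
    hom sSet (Dobj x) (Dobj y) -> hom sSet (Dobj x') (Dobj y') -> Prop :=
| DsqHid x y (l : hom sSet (Dobj x) (Dobj y)) :
    Dver l -> @Dsq x x y y l l (idc sSet (Dobj x)) (idc sSet (Dobj y))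
| DsqVid x y (u : hom sSet (Dobj x) (Dobj y)) :
    Dhor u -> @Dsq x y x y (idc sSet (Dobj x)) (idc sSet (Dobj y)) u u
| DsqHorn p (m : 'I_p.+2) b (s : smap (simplex p.+1) (simplex b)) :
    nonid_epi s ->
    @Dsq (Horn m) (Simplex b) (Simplex p.+1) (Simplex b)
      (horn_incl m) (smap_id (simplex b)) (smap_cmp s (horn_incl m)) s.

Lemma is_simplex_idE a b (s : smap (simplex a) (simplex b)) :
  is_simplex_id s ->
  exists e : a = b, s = ecast c (smap (simplex a) (simplex c)) e (smap_id _).
Proof. by case=> n; exists erefl. Qed.

Lemma is_simplex_id_refl n (s : smap (simplex n) (simplex n)) :
  is_simplex_id s -> s = smap_id _.
Proof. by case/is_simplex_idE=> e ->; rewrite (eq_axiomK e). Qed.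

Lemma simplex_smapE a (X : sset) (s : smap (simplex a) X) n
  (x : simplex a n) : s n x = act x (s a (mono_id a)).
Proof. by rewrite -sfun_nat /=; congr (s n _); apply: mono_eq. Qed.

Lemma mono_bij_id n (f g : mono n n) :
  cancel f g -> cancel g f -> forall i, f i = i.
Proof.
have inj_le (h h' : mono n n) : cancel h h' -> forall i : 'I_n.+1, (i <= h i)%N.
  move=> hK [i]; elim: i => [//|i IH] lti.
  have lti' := ltn_trans (ltnSn i) lti.
  apply: leq_ltn_trans (IH lti') _.
  have : h (Ordinal lti') <= h (Ordinal lti) by apply: mono_le.
  rewrite leq_eqVlt => /orP[/eqP/val_inj/(can_inj hK)/eqP|//].
  by rewrite -val_eqE /= ltn_eqF.
move=> fK gK i; apply: val_inj; apply/eqP; rewrite eqn_leq (inj_le f g) // andbT.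
by rewrite -{2}(fK i) (inj_le g f).
Qed.

Lemma epi_cmp_simplex_id a b c (s : smap (simplex a) (simplex b))
    (t : smap (simplex b) (simplex c)) :
  epi (C := sSet) s -> is_simplex_id (smap_cmp t s) -> is_simplex_id s.
Proof.
move=> es its; have [e _] := is_simplex_idE its; subst c.
move/is_simplex_id_refl: its => ts.
have st : smap_cmp s t = smap_id _.
  apply: es; change (smap_cmp (smap_cmp s t) s = smap_cmp (smap_id _) s).
  have -> : smap_cmp (smap_cmp s t) s = smap_cmp s (smap_cmp t s).
    exact: smap_eq.
  by rewrite ts; apply: smap_eq.
pose f : mono a b := s a (mono_id a); pose g : mono b a := t b (mono_id b).
have fK : cancel f g.
  move=> i; have := congr1 (fun h : smap (simplex a) (simplex a) => (h a (mono_id a) : mono a a) i) ts.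
  by rewrite /= simplex_smapE.
have gK : cancel g f.
  move=> i; have := congr1 (fun h : smap (simplex b) (simplex b) => (h b (mono_id b) : mono b b) i) st.
  by rewrite /= simplex_smapE.
have eab : a = b.
  by have := bij_eq_card (Bijective fK gK); rewrite !card_ord => -[].
clear ts st es; subst b.
suff -> : s = smap_id _ by constructor.
apply: smap_eq => n x; rewrite simplex_smapE; apply: mono_eq => i /=.
exact: (mono_bij_id fK gK).
Qed.

Lemma epi_id (C : category) (x : C) : epi (idc C x).
Proof. by move=> z g h; rewrite !cmpf1. Qed.

Lemma epi_cmp (C : category) (x y z : C) (t : hom C y z) (s : hom C x y) :
  epi t -> epi s -> epi (cmp t s).
Proof. by move=> et es w g h; rewrite !cmpA => /es/et. Qed.

Lemma nonid_epi_cmp a b c (s : smap (simplex a) (simplex b))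
    (t : smap (simplex b) (simplex c)) :
  epi (C := sSet) t -> nonid_epi s -> nonid_epi (smap_cmp t s).
Proof.
move=> et [es ns]; split; first exact: (epi_cmp (C := sSet) et es).
by move/(epi_cmp_simplex_id es).
Qed.

Lemma Dver_id_inv n y (l : hom sSet (simplex n) (Dobj y)) :
  @Dver (Simplex n) y l ->
  exists e : Simplex n = y,
    l = ecast z (hom sSet (simplex n) (Dobj z)) e (idc sSet (simplex n)).
Proof.
by move=> dl; dependent destruction dl; exists erefl.
Qed.

Lemma Dhor_simplex_inv a y (u : hom sSet (simplex a) (Dobj y)) :
  @Dhor (Simplex a) y u ->
  match y return hom sSet (simplex a) (Dobj y) -> Prop with
  | Simplex b => fun u => epi (C := sSet) u
  | Horn _ _ => fun _ => False
  end u.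
Proof.
by move=> du; dependent destruction du.
Qed.

Lemma Dver_cmp x y z (g : hom sSet (Dobj y) (Dobj z))
  (f : hom sSet (Dobj x) (Dobj y)) : Dver g -> Dver f -> Dver (cmp g f).
Proof.
move=> dg df; case: df g dg => [t g dg|p m g dg]; first by rewrite cmpf1.
have [e ->] := Dver_id_inv dg; case: _ / e.
by rewrite cmp1f; constructor.
Qed.

Lemma Dhor_cmp x y z (g : hom sSet (Dobj y) (Dobj z))
  (f : hom sSet (Dobj x) (Dobj y)) : Dhor g -> Dhor f -> Dhor (cmp g f).
Proof.
move=> dg df; case: df g dg => [a b s es|p m|p m b s ns] g dg.
- move/Dhor_simplex_inv: dg; case: z g => [n|//] g eg.
  by constructor; apply: epi_cmp.
- by rewrite (cmpf1 (c := sSet)).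
- move/Dhor_simplex_inv: dg; case: z g => [n|//] g eg.
  rewrite (_ : cmp g _ = smap_cmp (smap_cmp g s) (horn_incl m)).
    by constructor; apply: nonid_epi_cmp.
  exact: smap_eq.
Qed.

Lemma Dsq_comm x y x' y' (l : hom sSet (Dobj x) (Dobj x'))
  (r : hom sSet (Dobj y) (Dobj y')) (u : hom sSet (Dobj x) (Dobj y))
  (v : hom sSet (Dobj x') (Dobj y')) : Dsq l r u v -> comm_sq l r u v.
Proof.
case=> [a b k _|a b w _|p m b s _].
- exact: comm_sq_hid.
- exact: comm_sq_vid.
- exact: (cmp1f (c := sSet)).
Qed.

Lemma Dsq_hcmp x y z x' y' z' (l : hom sSet (Dobj x) (Dobj x'))
    (m : hom sSet (Dobj y) (Dobj y')) (r : hom sSet (Dobj z) (Dobj z'))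
    (u : hom sSet (Dobj x) (Dobj y)) (v : hom sSet (Dobj x') (Dobj y'))
    (u' : hom sSet (Dobj y) (Dobj z)) (v' : hom sSet (Dobj y') (Dobj z')) :
  Dsq m r u' v' -> Dsq l m u v -> Dsq l r (cmp u' u) (cmp v' v).
Proof.
move=> t s; case: s r u' v' t => [a b k dk|a b w dw|p k b s ns] r u' v' t.
- by rewrite !cmpf1.
- dependent destruction t; rewrite ?cmp1f; constructor=> //.
  exact: Dhor_cmp.
- dependent destruction t; rewrite ?cmp1f; first by constructor.
  move/Dhor_simplex_inv: H; case: y0 v' => [n|//] w ew.
  rewrite (_ : cmp w (smap_cmp _ _) = smap_cmp (smap_cmp w s) (horn_incl k)).
    by constructor; apply: nonid_epi_cmp.
  exact: smap_eq.
Qed.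

Lemma Dsq_vcmp x y x' y' x'' y'' (l : hom sSet (Dobj x) (Dobj x'))
    (r : hom sSet (Dobj y) (Dobj y')) (l' : hom sSet (Dobj x') (Dobj x''))
    (r' : hom sSet (Dobj y') (Dobj y'')) (u : hom sSet (Dobj x) (Dobj y))
    (v : hom sSet (Dobj x') (Dobj y')) (w : hom sSet (Dobj x'') (Dobj y'')) :
  Dsq l' r' v w -> Dsq l r u v -> Dsq (cmp l' l) (cmp r' r) u w.
Proof.
move=> t s; case: s l' r' w t => [a b k dk|a b h dh|p k b s ns] l' r' w t.
- dependent destruction t; last by rewrite !cmp1f; constructor.
  by constructor; apply: Dver_cmp.
- by rewrite !cmpf1.
- dependent destruction t; last by rewrite !cmp1f; constructor.
  by case: ns => _ []; constructor.
Qed.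

Lemma Dclosed : sub_closed (C := sSet) (F := Dobj) Dhor Dver Dsq.
Proof.
split.
- by case=> [n|p m]; constructor; apply: epi_id.
- exact: Dhor_cmp.
- exact: DverId.
- exact: Dver_cmp.
- exact: Dsq_comm.
- exact: DsqHid.
- exact: DsqVid.
- exact: Dsq_hcmp.
- exact: Dsq_vcmp.
Qed.

Definition D : dblcat := SubSq Dclosed.
Definition D_incl : dblfunctor D (Sq sSet) := SubSq_incl Dclosed.

Definition Dhorn p (m : 'I_p.+2) : ver D (Horn m) (Simplex p.+1) :=
  exist _ (horn_incl m : hom sSet (Dobj (Horn m)) (Dobj (Simplex p.+1)))
    (DverHorn m).

Definition horn_restriction (X Y : sset) (r : rlp (C := sSet) D_incl X Y) :
    kan_fibration X Y :=
  @KanFibration X Y (rlp_map r)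
    (fun p m x y e => @psi _ _ _ _ _ r _ _ (Dhorn m) x y e)
    (fun p m x y e => @psi_up _ _ _ _ _ r _ _ (Dhorn m) x y e)
    (fun p m x y e => @psi_down _ _ _ _ _ r _ _ (Dhorn m) x y e).

(* Main.v *)
Require Import Defs.
From mathcomp Require Import all_boot.
From mathcomp Require Import zify boolp.
From Stdlib Require Import Program.Equality.

Set Implicit Arguments.
Unset Strict Implicit.
Unset Printing Implicit Defensive.

(** A vertical arrow of [D] is an identity or a horn inclusion. A lift against
    an identity is forced, so [psi] carries the same data as its restriction to
    horns; the two compatibility conditions have to be matched with the
    preservation of degenerate solutions. Vertical compatibility is automatic,
    since one of two composable vertical arrows is always an identity. The only
    informative squares are those with left side a horn inclusion, right side
    the identity of [simplex b] and bottom a non-identity epimorphism [s];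
    horizontal compatibility there says that the chosen solution of a problem
    [(z s iota, f z s)] is [z s].

    For [s] a codegeneracy [degen j] this makes every chosen solution degenerate
    as soon as a degenerate solution exists ([horn_restriction_degenerate]).
    Conversely, let the lifts of a Kan fibration preserve degenerate solutions.
    A non-identity epimorphism out of [simplex p.+1] identifies two consecutive
    vertices, so [z s] is a degenerate solution ([nonid_epi_degenerate]) and the
    chosen lift is degenerate too. It remains to see that two degenerate
    simplices with the same restriction to a horn are equal
    ([degenerate_filler_uniq]).

    For this last point, a simplex [d] is [degen j]-degenerate iff it is
    invariant under the idempotent operator [toward m j] of [p.+1], which moves
    one of the vertices [j], [j.+1] onto the other one, the latter being the
    closer to [m]. The choice of direction has two effects. The image of
    [toward m j] misses a vertex other than [m], so [d (toward m j)] depends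
    only on the restriction of [d] to the [m]-th horn. And two such idempotents
    [e], [e'] satisfy an absorption law, [e e' e = e e'] or [e' e e' = e' e]
    ([toward_absorb]); for [d] invariant under [e] and [d'] under [e'], either
    law turns the equalities [d = d' e] and [d' = d e'] into [d = d']. *)

(** * Idempotents collapsing two consecutive vertices *)

(** Innermost conditionals go first, so that every hypothesis produced is plain
    arithmetic. *)
Ltac split_ifs :=
  repeat match goal with
  | |- context [if ?b then _ else _] =>
    lazymatch b with
    | context [if _ then _ else _] => fail
    | _ => case: (boolP b) => ?
    end
  end.

Definition toward_face p (m : 'I_p.+2) (j : 'I_p.+1) : 'I_p.+2 :=
  if m <= j then lift ord0 j else widen_ord (leqnSn _) j.

(** The idempotent that collapses [j] and [j.+1] onto the closer to [m] of the
    two. The vertex it misses is [toward_face m j]. *)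
Definition toward p (m : 'I_p.+2) (j : 'I_p.+1) : mono p.+1 p.+1 :=
  mono_cmp (coface (toward_face m j)) (codeg j).

Lemma toward_faceE p (m : 'I_p.+2) (j : 'I_p.+1) :
  toward_face m j = (if m <= j then j.+1 else j) :> nat.
Proof. by rewrite /toward_face; case: ifP. Qed.

Lemma toward_face_neq p (m : 'I_p.+2) (j : 'I_p.+1) : toward_face m j <> m.
Proof. by move/(congr1 val); rewrite /= toward_faceE; case: ifP; lia. Qed.

Lemma towardE p (m : 'I_p.+2) (j : 'I_p.+1) (t : 'I_p.+2) :
  toward m j t = (if m <= j then (if t == j.+1 :> nat then j : nat else t)
                  else (if t == j :> nat then j.+1 else t)) :> nat.
Proof.
rewrite /= toward_faceE /bump /unbump.
by case: (leqP m j); case: eqP; lia.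
Qed.

Lemma codeg_toward_face p (m : 'I_p.+2) (j : 'I_p.+1) :
  mono_cmp (codeg j) (coface (toward_face m j)) = mono_id p.
Proof.
apply: mono_eq => t; apply: val_inj; rewrite /= toward_faceE /bump /unbump.
by case: (leqP m j); lia.
Qed.

(** If [m] does not separate the two collapsed pairs, both idempotents push the
    same way: when the pairs overlap in a vertex, pushing first from the pair
    farther from [m] sends all three vertices to the one closest to [m]. If [m]
    separates them, or the pairs are disjoint, the two idempotents commute, and
    idempotence gives both laws. *)
Lemma toward_absorb p (m : 'I_p.+2) (i j : 'I_p.+1) : i <= j ->
  let e := toward m i in let e' := toward m j in
  mono_cmp e (mono_cmp e' e) = mono_cmp e e' \/
  mono_cmp e' (mono_cmp e e') = mono_cmp e' e.
Proof.
move=> le_ij e e'.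
case: (leqP m j) => le_mj; [left | right]; apply: mono_eq => t; apply: val_inj.
- rewrite -[LHS]/(nat_of_ord (e (e' (e t)))) -[RHS]/(nat_of_ord (e (e' t))).
  rewrite !towardE le_mj; case: (leqP m i) => le_mi; split_ifs; lia.
- rewrite -[LHS]/(nat_of_ord (e' (e (e' t)))) -[RHS]/(nat_of_ord (e' (e t))).
  rewrite !towardE; split_ifs; lia.
Qed.

(** * Degenerate simplices are determined by a horn *)

Section Degenerate.
Variable X : sset.

Lemma comp_simplex_map2 p q r (d : smap (simplex r) X) (g : mono q r)
    (f : mono p q) :
  smap_cmp (smap_cmp d (simplex_map g)) (simplex_map f) =
  smap_cmp d (simplex_map (mono_cmp g f)).
Proof. exact: smap_eq. Qed.

Lemma degenerate_toward p (m : 'I_p.+2) (d : smap (simplex p.+1) X) :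
  is_degenerate d ->
  exists j : 'I_p.+1, d = smap_cmp d (simplex_map (toward m j)).
Proof.
case=> j [z ->]; exists j; rewrite /degen comp_simplex_map2.
congr (smap_cmp _ (simplex_map _)).
transitivity (mono_cmp (mono_cmp (codeg j) (coface (toward_face m j)))
                (codeg j)); last by [].
by rewrite codeg_toward_face; apply: mono_eq.
Qed.

Lemma toward_degenerate p (m : 'I_p.+2) j (d : smap (simplex p.+1) X) :
  d = smap_cmp d (simplex_map (toward m j)) -> is_degenerate d.
Proof.
move=> dE; exists j, (smap_cmp d (simplex_map (coface (toward_face m j)))).
by rewrite /degen comp_simplex_map2.
Qed.

(** Up to simplicial identities, [d (toward m j)] is a degeneracy of the face
    [toward_face m j] of [d], and that face belongs to the horn. *)
Lemma toward_horn p (m : 'I_p.+2) j (d d' : smap (simplex p.+1) X) :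
  smap_cmp d (horn_incl m) = smap_cmp d' (horn_incl m) ->
  smap_cmp d (simplex_map (toward m j)) =
  smap_cmp d' (simplex_map (toward m j)).
Proof.
move=> dd'; apply: smap_eq => n x.
have hx : in_horn m (mono_cmp (toward m j) x : simplex p.+1 n).
  exists (toward_face m j); split; first exact: toward_face_neq.
  by exists (mono_cmp (codeg j) x); apply: mono_eq.
exact: (congr1 (fun h : smap (horn m) X => h n (exist _ _ hx)) dd').
Qed.

(** Let [d] be invariant under [e] and [d'] under [e']. On the horn both agree,
    so [d = d e = d' e] and [d' = d' e' = d e']; hence [d = d e' e], and the law
    [e' e e' = e' e] gives [d' = d e' = d e' e e' = d e' e = d]. The other
    absorption law is the same with the two simplices exchanged. *)
Lemma degenerate_filler_uniq p (m : 'I_p.+2) (d d' : smap (simplex p.+1) X) :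
  is_degenerate d -> is_degenerate d' ->
  smap_cmp d (horn_incl m) = smap_cmp d' (horn_incl m) -> d = d'.
Proof.
have absorb (c c' : smap (simplex p.+1) X) i j :
    c = smap_cmp c (simplex_map (toward m i)) ->
    c' = smap_cmp c' (simplex_map (toward m j)) ->
    smap_cmp c (horn_incl m) = smap_cmp c' (horn_incl m) ->
    mono_cmp (toward m j) (mono_cmp (toward m i) (toward m j)) =
      mono_cmp (toward m j) (toward m i) -> c = c'.
  move=> cE c'E cc' abs.
  have c_c' : c = smap_cmp c' (simplex_map (toward m i)).
    by rewrite -(toward_horn i cc').
  have c'_c : c' = smap_cmp c (simplex_map (toward m j)).
    by rewrite (toward_horn j cc').
  have c_ji : c = smap_cmp c (simplex_map (mono_cmp (toward m j) (toward m i))).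
    by rewrite -comp_simplex_map2 -c'_c.
  rewrite [RHS]c'_c {2}c_ji comp_simplex_map2 {1}c_ji -{1}abs.
  by congr (smap_cmp _ (simplex_map _)); apply: mono_eq.
move=> /(degenerate_toward m)[i dE] /(degenerate_toward m)[j d'E] dd'.
case: (leqP i j) => [le_ij | /ltnW le_ji].
- have [abs | abs] := toward_absorb m le_ij; last exact: absorb dE d'E dd' abs.
  by apply: esym; apply: absorb d'E dE _ abs.
- have [abs | abs] := toward_absorb m le_ji; first exact: absorb dE d'E dd' abs.
  by apply: esym; apply: absorb d'E dE _ abs.
Qed.

End Degenerate.

(** * Epimorphisms between simplices *)

(** Every set is the set of vertices of this simplicial set, and maps into it
    are arbitrary functions on vertices; it serves to test epimorphisms. *)
Definition indiscrete (T : Type) : sset.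
Proof.
by exists (fun n => 'I_n.+1 -> T) (fun k n (f : mono k n) x => x \o f).
Defined.

Definition to_indiscrete n (T : Type) (g : 'I_n.+1 -> T) :
  smap (simplex n) (indiscrete T).
Proof. by exists (fun k (x : simplex n k) => g \o x). Defined.

Definition vertex_map a b (s : smap (simplex a) (simplex b)) : mono a b :=
  s a (mono_id a).

Lemma vertex_mapK a b (s : smap (simplex a) (simplex b)) :
  simplex_map (vertex_map s) = s.
Proof. by apply: smap_eq => n x; rewrite [RHS]simplex_smapE. Qed.

(** If the vertex [i] is missed, the characteristic function of [i] and the zero
    function are distinct maps to [indiscrete bool] with equal composites. *)
Lemma epi_vertex_surj a b (s : smap (simplex a) (simplex b)) :
  epi (C := sSet) s -> forall i, exists t, vertex_map s t = i.
Proof.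
move=> es i; apply: contrapT => no_t.
pose g := to_indiscrete (fun=> false) : smap (simplex b) (indiscrete bool).
pose h := to_indiscrete (pred1 i) : smap (simplex b) (indiscrete bool).
suff /es gh : cmp (c := sSet) g s = cmp (c := sSet) h s.
  have := congr1 (fun f : smap (simplex b) (indiscrete bool) =>
                    f b (mono_id b) i) gh.
  by rewrite /= eqxx.
rewrite -(vertex_mapK s); apply: smap_eq => n x; apply: funext => t /=.
by apply: esym; apply/negbTE/eqP => e; apply: no_t; exists (x t).
Qed.

(** A monotone surjection without repetition is strictly increasing, hence an
    isomorphism of finite linear orders, hence an identity. *)
Lemma nonid_epi_repeats p b (s : smap (simplex p.+1) (simplex b)) :
  nonid_epi s -> exists j : 'I_p.+1,
    vertex_map s (widen_ord (leqnSn _) j) = vertex_map s (lift ord0 j).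
Proof.
move=> [es ns]; apply: contrapT => no_j; apply: ns.
have surj := epi_vertex_surj es; rewrite -(vertex_mapK s).
move: (vertex_map s) no_j surj => f no_j surj {s es}.
have ltf (j : 'I_p.+1) : f (widen_ord (leqnSn _) j) < f (lift ord0 j).
  rewrite ltn_neqAle mono_le ?andbT /=; last by rewrite /bump; lia.
  by apply/eqP => /val_inj e; apply: no_j; exists j.
have injf : injective f.
  suff H (x y : 'I_p.+2) : x < y -> f x < f y.
    move=> x y fxy; apply: val_inj; case: (ltngtP x y) => // /H;
    by rewrite fxy ltnn.
  move=> lt_xy; have ltx : x < p.+1 by have := ltn_ord y; lia.
  have := ltf (Ordinal ltx).
  rewrite (_ : widen_ord _ _ = x); last exact: val_inj.
  by move/leq_trans; apply; apply: mono_le; rewrite /= /bump; lia.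
have [g gK] := choice surj.
have fK : cancel f g by move=> x; apply: injf; rewrite gK.
have mono_g (i j : 'I_b.+1) : i <= j -> g i <= g j.
  move=> le_ij; case: (leqP (g i) (g j)) => // lt_gji.
  have := mono_le f (ltnW lt_gji); rewrite !gK => le_ji.
  have eij : i = j by apply: val_inj; apply/eqP; rewrite eqn_leq le_ij.
  by rewrite eij ltnn in lt_gji.
have eb : p.+1 = b.
  by have := bij_eq_card (Bijective fK gK); rewrite !card_ord => -[].
subst b; rewrite (_ : simplex_map f = smap_id _); first by constructor.
apply: smap_eq => n x; apply: mono_eq => t /=.
exact: (@mono_bij_id _ f (Mono mono_g) fK gK).
Qed.

(** A map taking equal values at [j] and [j.+1] is unchanged by precomposition
    with a collapse of these two vertices. *)
Lemma nonid_epi_degenerate X p b (s : smap (simplex p.+1) (simplex b))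
    (z : smap (simplex b) X) : nonid_epi s -> is_degenerate (smap_cmp z s).
Proof.
case/nonid_epi_repeats=> j ej.
(* The choice of [ord0] gives the collapse [j.+1 |-> j]. *)
apply: (@toward_degenerate _ _ ord0 j).
have s_toward (t : 'I_p.+2) : vertex_map s t = vertex_map s (toward ord0 j t).
  case: (t =P lift ord0 j) => [-> | nt].
    rewrite -ej; congr (vertex_map s _); apply: ord_inj.
    by rewrite towardE /= eqxx.
  congr (vertex_map s _); apply: ord_inj; rewrite towardE leq0n.
  by case: eqP => // et; case: nt; apply: val_inj.
rewrite -(vertex_mapK s); apply: smap_eq => n x; congr (z n _).
by apply: mono_eq => t; apply: s_toward.
Qed.

Lemma degen_nonid_epi p (j : 'I_p.+1) : nonid_epi (degen j).
Proof.
split; last by move/is_simplex_idE => [e _]; lia.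
move=> Z g h e.
have degenK : smap_cmp (degen j) (face (toward_face ord0 j)) = smap_id _.
  apply: smap_eq => n x /=; apply: mono_eq => t.
  exact: (congr1 (fun h : mono p p => h (x t)) (codeg_toward_face ord0 j)).
rewrite -[g](cmpf1 (c := sSet)) -[h](cmpf1 (c := sSet)).
rewrite -[idc _ _]degenK.
rewrite -[smap_cmp _ _]/(cmp (c := sSet) (degen j) (face (toward_face ord0 j))).
by rewrite !cmpA e.
Qed.

(** * Lifting structures against [D] *)

Section RLP.
Variables X Y : sset.

Lemma kan_lift_irrel (k k' : kan_fibration X Y) p (m : 'I_p.+2) x x' y y'
    (e : smap_cmp (kan_map k) x = smap_cmp y (horn_incl m))
    (e' : smap_cmp (kan_map k') x' = smap_cmp y' (horn_incl m)) :
  k = k' -> x = x' -> y = y' -> kan_lift e = kan_lift e'.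
Proof.
by move=> ek ex ey; subst; rewrite (Prop_irrelevance e e').
Qed.

Lemma kan_fibration_eq (k k' : kan_fibration X Y) :
  kan_map k = kan_map k' ->
  (forall p (m : 'I_p.+2) x y
     (e : smap_cmp (kan_map k) x = smap_cmp y (horn_incl m))
     (e' : smap_cmp (kan_map k') x = smap_cmp y (horn_incl m)),
     kan_lift e = kan_lift e') ->
  k = k'.
Proof.
case: k k' => [f h hu hd] [f' h' hu' hd'] /= ef; subst f' => eh.
have {}eh : h = h'.
  do 5 (apply: functional_extensionality_dep => ?); exact: eh.
by subst h'; rewrite (Prop_irrelevance hu hu') (Prop_irrelevance hd hd').
Qed.

Notation RLP := (rlp (C := sSet) D_incl X Y).

Lemma rlp_eq (r r' : RLP) :
  rlp_map r = rlp_map r' ->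
  (forall A B (l : ver D A B) u v (s : comm_sq (fver D_incl l) (rlp_map r) u v)
     (s' : comm_sq (fver D_incl l) (rlp_map r') u v), psi s = psi s') ->
  r = r'.
Proof.
case: r r' => [f h hu hd hh hv] [f' h' hu' hd' hh' hv'] /= ef; subst f' => eh.
have {}eh : h = h'.
  do 6 (apply: functional_extensionality_dep => ?); exact: eh.
subst h'; rewrite (Prop_irrelevance hu hu') (Prop_irrelevance hd hd').
by rewrite (Prop_irrelevance hh hh') (Prop_irrelevance hv hv').
Qed.

Lemma ver_ind (P : forall A B, ver D A B -> Prop) :
  (forall A, P A A (idc (vcat D) A)) ->
  (forall p (m : 'I_p.+2), P (Horn m) (Simplex p.+1) (Dhorn m)) ->
  forall A B (l : ver D A B), P A B l.
Proof.
move=> Pid Phorn A B [l dl].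
case: _ _ l / dl => [x | p m]; last exact: Phorn.
by have := Pid x; congr (P x x _); apply: sval_eq.
Qed.

Lemma psi_id (r : RLP) (A : D) u v
    (s : comm_sq (fver D_incl (idc (vcat D) A)) (rlp_map r) u v) :
  psi s = u.
Proof.
by rewrite -[RHS](psi_up s); apply: esym; apply: (cmpf1 (c := sSet)).
Qed.

(** The square with bottom [degen j] and right side an identity forces the lift
    of a problem solved by [z (degen j)] to factor through [degen j]. *)
Lemma horn_restriction_degenerate (r : RLP) :
  degenerate_preferring (horn_restriction r).
Proof.
move=> p m x y e [d [[dx dy] [j [z dE]]]].
split; first by split; [apply: kan_lift_up | apply: kan_lift_down].
pose a : hor D (Horn m) (Simplex p) :=
  exist _ (smap_cmp (degen j) (horn_incl m)
             : hom sSet (Dobj (Horn m)) (Dobj (Simplex p)))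
    (DhorHorn m (degen_nonid_epi j)).
pose b : hor D (Simplex p.+1) (Simplex p) :=
  exist _ (degen j : hom sSet (Dobj (Simplex p.+1)) (Dobj (Simplex p)))
    (DhorEpi (proj1 (degen_nonid_epi j))).
have sq : sq (d := D) (Dhorn m) (idc (vcat D) (Simplex p)) a b.
  exact: DsqHorn (degen_nonid_epi j).
have s : comm_sq (C := sSet) (fver D_incl (idc (vcat D) (Simplex p)))
    (rlp_map r) z (smap_cmp (rlp_map r) z) by exact: smap_eq.
have xE : cmp (c := sSet) z (fhor D_incl a : hom sSet _ _) = x.
  by rewrite -dx dE; apply: smap_eq.
have yE : cmp (c := sSet) (smap_cmp (rlp_map r) z)
    (fhor D_incl b : hom sSet _ _) = y.
  by rewrite -dy dE; apply: smap_eq.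
clear d dx dy dE; subst x y; exists j, (psi s).
exact: (psi_hor sq s e).
Qed.

Lemma horn_restriction_inj : injective (@horn_restriction X Y).
Proof.
move=> r r' err'; apply: rlp_eq; first exact: (congr1 (@kan_map X Y) err').
apply: ver_ind => [A | p m] u v s s'; first by rewrite !psi_id.
exact: (kan_lift_irrel (k := horn_restriction r) (k' := horn_restriction r')).
Qed.

Section Extension.
Variable k : kan_fibration X Y.

(** The graph of the only possible extension of [k] to all vertical arrows. A
    relation is used because [Dver] is a proposition, which cannot be analysed
    when constructing a map; the function [fill] is then chosen from it. *)
Inductive fills : forall A B, hom sSet (Dobj A) (Dobj B) ->
    hom sSet (Dobj A) X -> hom sSet (Dobj B) Y -> hom sSet (Dobj B) X -> Prop :=
| FillsId A (u : hom sSet (Dobj A) X) v :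
    @fills A A (idc sSet (Dobj A)) u v u
| FillsHorn p (m : 'I_p.+2) x y
    (e : smap_cmp (kan_map k) x = smap_cmp y (horn_incl m)) :
    @fills (Horn m) (Simplex p.+1) (horn_incl m) x y (kan_lift e).

Lemma fills_id A (u : hom sSet (Dobj A) X) v d :
  @fills A A (idc sSet (Dobj A)) u v d -> d = u.
Proof. by move=> h; dependent destruction h. Qed.

Lemma fills_ex A B (l : ver D A B) u v :
  comm_sq (fver D_incl l) (kan_map k : hom sSet X Y) u v ->
  exists d, @fills A B (sval l) u v d.
Proof.
move: A B l u v; apply: ver_ind => [A | p m] u v s.
  by exists u; constructor.
by exists (kan_lift s); constructor.
Qed.

Lemma fills_uniq A B l u v d d' :
  @fills A B l u v d -> @fills A B l u v d' -> d = d'.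
Proof.
move=> h h'; move: d' h'.
case: A B l u v d / h => [A u v d' /fills_id //| p m x y e d' h].
dependent destruction h.
exact: kan_lift_irrel.
Qed.

Lemma fills_solves A B l u v d :
  @fills A B l u v d -> comm_sq l (kan_map k : hom sSet X Y) u v ->
  cmp d l = u /\ cmp (kan_map k : hom sSet X Y) d = v.
Proof.
case=> {A B l u v d} [A u v | p m x y e] s.
  by rewrite cmpf1; move: s; rewrite /comm_sq cmpf1.
by split; [apply: kan_lift_up | apply: kan_lift_down].
Qed.

(** A vertical arrow that can be followed by a horn inclusion ends at a horn, so
    it is an identity and its lift is forced. *)
Lemma fills_ver A B B' (l : hom sSet (Dobj A) (Dobj B))
    (l' : hom sSet (Dobj B) (Dobj B')) u v d d' :
  Dver l ->
  @fills A B l u (cmp v l') d -> @fills B B' l' d v d' ->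
  @fills A B' (cmp l' l) u v d'.
Proof.
move=> dl h h'; move: l dl h.
case: B B' l' d v d' / h' => [C d v | p m x y e] l dl h.
  by rewrite cmp1f; rewrite cmpf1 in h.
dependent destruction dl.
by rewrite cmpf1; rewrite -(fills_id h); constructor.
Qed.

Hypothesis k_deg : degenerate_preferring k.

(** The lift and [z s] are both degenerate solutions of the same problem, hence
    equal. *)
Lemma kan_lift_nonid_epi p (m : 'I_p.+2) b (s : smap (simplex p.+1) (simplex b))
    (z : smap (simplex b) X) x y
    (e : smap_cmp (kan_map k) x = smap_cmp y (horn_incl m)) :
  nonid_epi s -> is_solution (kan_map k) x y (smap_cmp z s) ->
  kan_lift e = smap_cmp z s.
Proof.
move=> ns sol; have zs_deg := nonid_epi_degenerate z ns.
have [[lift_x _] lift_deg] := k_deg e (ex_intro _ _ (conj sol zs_deg)).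
apply: (degenerate_filler_uniq (m := m) lift_deg zs_deg).
by rewrite lift_x (proj1 sol).
Qed.

Lemma fills_hor A B A' B' (l' : hom sSet (Dobj A') (Dobj B'))
    (l : hom sSet (Dobj A) (Dobj B)) a b u v d :
  Dsq l' l a b -> comm_sq l (kan_map k : hom sSet X Y) u v ->
  @fills A B l u v d -> @fills A' B' l' (cmp u a) (cmp v b) (cmp d b).
Proof.
move=> sq.
case: _ _ _ _ l' l a b / sq u v d => [x y l _|x y a _|p m b s ns] u v d.
- by rewrite !cmpf1.
- by move=> _ /fills_id ->; constructor.
- move=> sq /(@fills_id (Simplex b)) ->.
  move: sq; rewrite /comm_sq => uv.
  have {}uv : v = smap_cmp (kan_map k) u.
    by rewrite -[v](cmpf1 (c := sSet)) -[LHS]uv.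
  have e : smap_cmp (kan_map k)
      (cmp (c := sSet) u (smap_cmp s (horn_incl m))) =
      smap_cmp (cmp (c := sSet) v (s : hom sSet (simplex _) (simplex _)))
        (horn_incl m).
    by rewrite uv; apply: smap_eq.
  have liftE : kan_lift e = smap_cmp u s.
    apply: kan_lift_nonid_epi ns _; split; first exact: smap_eq.
    by rewrite uv; apply: smap_eq.
  by rewrite -[X in fills _ _ _ X]/(smap_cmp u s) -liftE; constructor.
Qed.

Definition fill A B (l : ver D A B) u v
    (s : comm_sq (fver D_incl l) (kan_map k : hom sSet X Y) u v) :
  hom sSet (Dobj B) X := sval (cid (fills_ex s)).

Lemma fillP A B (l : ver D A B) u v
    (s : comm_sq (fver D_incl l) (kan_map k : hom sSet X Y) u v) :
  @fills A B (sval l) u v (fill s).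
Proof. by rewrite /fill; case: cid. Qed.

Lemma horn_restriction_surj : exists r : RLP, horn_restriction r = k.
Proof.
unshelve refine (let r : RLP :=
  @Rlp sSet D D_incl X Y (kan_map k) fill _ _ _ _ in ex_intro _ r _).
- by move=> A B l u v s; case: (fills_solves (fillP s) s).
- by move=> A B l u v s; case: (fills_solves (fillP s) s).
- move=> A' B' A B l' l a b sq u v s s'.
  exact: fills_uniq (fillP s') (fills_hor sq s (fillP s)).
- move=> A B B' l l' u v s s1 s2.
  exact: fills_uniq (fillP s) (fills_ver (svalP l) (fillP s1) (fillP s2)).
apply: kan_fibration_eq => // p m x y e e'.
exact: fills_uniq (fillP (l := Dhorn m) e) (FillsHorn e').
Qed.

End Extension.
End RLP.

Theorem theorem4p4 (X Y : sset) :
  [/\ forall r : rlp (C := sSet) D_incl X Y,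
        degenerate_preferring (horn_restriction r),
      injective (@horn_restriction X Y)
    & forall k : kan_fibration X Y, degenerate_preferring k ->
        exists r : rlp (C := sSet) D_incl X Y, horn_restriction r = k].
Proof.
split.
- exact: horn_restriction_degenerate.
- exact: horn_restriction_inj.
- exact: horn_restriction_surj.
Qed.
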